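(* Let $\mathcal A\in\mathbb C^{\mathbf I\times\mathbf I}$, $\mathcal B\in\mathbb C^{\mathbf H\times\mathbf I}$, $\mathcal C\in\mathbb C^{\mathbf I\times\mathbf H}$, $\mathcal D\in\mathbb C^{\mathbf H\times\mathbf H}$ be complex tensors. Put $\mathcal A^e=\mathcal A\mathcal A^D$, $\mathcal A^\pi=\mathcal I-\mathcal A\mathcal A^D$, $\mathcal Y=\mathcal C\mathcal D^D\mathcal B$, $\mathcal S=\mathcal A-\mathcal C\mathcal D^D\mathcal B$, $\mathcal Z=\mathcal D-\mathcal B\mathcal A^D\mathcal C$, $\mathcal H=\mathcal B\mathcal A^D$, $\mathcal K=\mathcal A^D\mathcal C$, $\mathcal S_{\mathcal A^e}=\mathcal A^e\mathcal S\mathcal A^e$ and $\mathcal T=\mathcal A^D+\mathcal K\mathcal Z^D\mathcal H$. Assume that $\mathcal S_{\mathcal A^e}\mathcal T=\mathcal A\mathcal A^D$ and that $\mathcal A^\pi\mathcal S$ is $r$-nilpotent for a positive integer $r$. (a) If $\mathcal A^e\mathcal Y\mathcal A^\pi\mathcal S=0$, then $$\mathcal S^D=-\sum_{i=0}^{r-2}\mathcal S^i\mathcal A^\pi\mathcal Y\mathcal T^{i+2}(\mathcal I-\mathcal T\mathcal Y\mathcal A^\pi)+\mathcal T-\mathcal T^2\mathcal Y\mathcal A^\pi .$$ (b) If $\mathcal A^\pi\mathcal Y\mathcal A^e\mathcal S=0$, then $$\mathcal S^D=-\sum_{i=0}^{r-1}\mathcal T^{i+2}\mathcal Y\mathcal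 A^\pi\mathcal S^i+\mathcal T .$$
   Context: Fix positive integers $N,M,I_1,\dots,I_N,H_1,\dots,H_M$; write $\mathbf I=I_1\times\cdots\times I_N$ and $\mathbf H=H_1\times\cdots\times H_M$, and let $\mathbb C^{\mathbf J\times\mathbf L}$ ($\mathbf J,\mathbf L\in\{\mathbf I,\mathbf H\}$) denote the complex tensors with row multi-index in $\mathbf J$ and column multi-index in $\mathbf L$. Juxtaposition denotes the Einstein product (written $*_N$ in the paper): $(\mathcal P\mathcal Q)_{\mathbf j\mathbf l}=\sum_{\mathbf h}\mathcal P_{\mathbf j\mathbf h}\mathcal Q_{\mathbf h\mathbf l}$, the sum running over all values of the shared multi-index $\mathbf h$; it is associative. A tensor in $\mathbb C^{\mathbf J\times\mathbf J}$ is called square; $\mathcal I$ is the unit tensor (diagonal entries $1$, all others $0$) and $\mathcal P^0=\mathcal I$. The index $\mathrm{ind}(\mathcal P)$ of a square tensor is the smallest integer $l\ge 0$ such that $\mathcal P^l$ and $\mathcal P^{l+1}$ have the same range, where the range of $\mathcal P$ is $\{\mathcal P\mathcal X\}$. The Drazin inverse $\mathcal P^D$ is the (unique, always existing) square tensor $\mathcal X$ with $\mathcal P^l\mathcal X\mathcal P=\mathcal P^l$, $\mathcal X\mathcal P\mathcal X=\mathcal X$, $\mathcal P\mathcal X=\mathcal X\mathcal P$, where $l\ge\mathrm{ind}(\mathcal P)$. A square tensor $\mathcal P$ is $l$-nilpotent ($l$ a positive integer) if $\mathcal P^l=0$. A sum whose lower limit exceeds its upper limit is $0$. *)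

(* Defs.v *)
From mathcomp Require Export all_boot all_order all_algebra.
From mathcomp Require Export complex.
From mathcomp Require Export boolp classical_sets reals.

Set Implicit Arguments.
Unset Strict Implicit.
Unset Printing Implicit Defensive.

Import GRing.Theory.
Local Open Scope ring_scope.

(* A multi-index (j_1, ..., j_N) with j_k ranging over d_k values. *)
Definition multiindex (N : nat) (d : 'I_N -> nat) : finType :=
  {dffun forall k : 'I_N, 'I_(d k)}.

Definition tensor (K : fieldType) (J L : finType) := {ffun J * L -> K}.

Definition einstein (K : fieldType) (J L M : finType)
    (P : tensor K J L) (Q : tensor K L M) : tensor K J M :=
  [ffun jm => \sum_h P (jm.1, h) * Q (h, jm.2)].

Notation "P *E Q" := (einstein P Q) (at level 40, left associativity).

Definition unit_tensor (K : fieldType) (J : finType) : tensor K J J :=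
  [ffun jl => (jl.1 == jl.2)%:R].

Notation "\I" := (unit_tensor _ _) (at level 0).

Definition tpow (K : fieldType) (J : finType) (P : tensor K J J) (l : nat)
  : tensor K J J := iter l (einstein P) \I.
Arguments tpow : simpl never.

Notation "P ^E l" := (tpow P l) (at level 29, left associativity).

(* The tensors X here are the "vectors" of C^J: their column index is trivial. *)
Definition trange (K : fieldType) (J : finType) (P : tensor K J J)
  : set (tensor K J unit) := range (fun X : tensor K J unit => P *E X).

Section EinsteinTheory.
Variable K : fieldType.
Implicit Types J L M : finType.

Lemma einsteinA J L M M' (P : tensor K J L) (Q : tensor K L M)
  (S : tensor K M M') : P *E (Q *E S) = P *E Q *E S.
Proof.
apply/ffunP=> jm; rewrite !ffunE /=.
under eq_bigr do rewrite ffunE mulr_sumr.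
rewrite exchange_big; apply: eq_bigr => i _ /=.
by rewrite ffunE mulr_suml; apply: eq_bigr => j _ /=; rewrite mulrA.
Qed.

Lemma einstein1l J L (P : tensor K J L) : \I *E P = P.
Proof.
apply/ffunP=> -[j l]; rewrite !ffunE /= (bigD1 j) //= ffunE eqxx mul1r.
by rewrite big1 ?addr0 // => i ne; rewrite ffunE /= eq_sym (negPf ne) mul0r.
Qed.

Lemma einstein1r J L (P : tensor K J L) : P *E \I = P.
Proof.
apply/ffunP=> -[j l]; rewrite !ffunE /= (bigD1 l) //= ffunE eqxx mulr1.
by rewrite big1 ?addr0 // => i ne; rewrite ffunE /= (negPf ne) mulr0.
Qed.

Lemma einsteinDr J L M (P : tensor K J L) (Q Q' : tensor K L M) :
  P *E (Q + Q') = P *E Q + P *E Q'.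
Proof.
apply/ffunP=> jm; rewrite !ffunE -big_split /=.
by apply: eq_bigr => h _; rewrite ffunE mulrDr.
Qed.

Lemma einsteinDl J L M (P P' : tensor K J L) (Q : tensor K L M) :
  (P + P') *E Q = P *E Q + P' *E Q.
Proof.
apply/ffunP=> jm; rewrite !ffunE -big_split /=.
by apply: eq_bigr => h _; rewrite ffunE mulrDl.
Qed.

Lemma einstein0l J L M (Q : tensor K L M) : (0 : tensor K J L) *E Q = 0.
Proof. by apply: (addrI (0 *E Q)); rewrite -einsteinDl !addr0. Qed.

Lemma einstein0r J L M (P : tensor K J L) : P *E (0 : tensor K L M) = 0.
Proof. by apply: (addrI (P *E 0)); rewrite -einsteinDr !addr0. Qed.

Lemma tpowS J (P : tensor K J J) l : P ^E l.+1 = P *E P ^E l.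
Proof. by []. Qed.

Lemma tpowD J (P : tensor K J J) k l : P ^E (k + l) = P ^E k *E P ^E l.
Proof.
elim: k => [|k IHk]; first by rewrite add0n [P ^E 0]/(\I) einstein1l.
by rewrite addSn !tpowS IHk einsteinA.
Qed.

Lemma tpow1 J (P : tensor K J J) : P ^E 1 = P.
Proof. exact: einstein1r. Qed.

Lemma tpowSr J (P : tensor K J J) l : P ^E l.+1 = P ^E l *E P.
Proof. by rewrite -addn1 tpowD tpow1. Qed.

Lemma tpow_comm J (P Q : tensor K J J) l :
  P *E Q = Q *E P -> P ^E l *E Q = Q *E P ^E l.
Proof.
move=> PQ; elim: l => [|l IHl]; first by rewrite einstein1l einstein1r.
by rewrite tpowS -einsteinA IHl !einsteinA PQ.
Qed.

Definition tscale J L (c : K) (P : tensor K J L) : tensor K J L :=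
  [ffun jl => c * P jl].

Lemma einsteinZr J L M c (P : tensor K J L) (Q : tensor K L M) :
  P *E tscale c Q = tscale c (P *E Q).
Proof.
apply/ffunP=> jm; rewrite !ffunE mulr_sumr.
by apply: eq_bigr => h _; rewrite ffunE mulrCA.
Qed.

Lemma einsteinZl J L M c (P : tensor K J L) (Q : tensor K L M) :
  tscale c P *E Q = tscale c (P *E Q).
Proof.
apply/ffunP=> jm; rewrite !ffunE mulr_sumr.
by apply: eq_bigr => h _; rewrite ffunE mulrA.
Qed.

Lemma einstein_sumr J L M (I : Type) (r : seq I) (Pr : pred I)
    (P : tensor K J L) (Q : I -> tensor K L M) :
  P *E (\sum_(i <- r | Pr i) Q i) = \sum_(i <- r | Pr i) P *E Q i.
Proof.
by apply: (big_morph (einstein P)); [exact: einsteinDr | exact: einstein0r].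
Qed.

Lemma einstein_suml J L M (I : Type) (r : seq I) (Pr : pred I)
    (Q : tensor K L M) (P : I -> tensor K J L) :
  (\sum_(i <- r | Pr i) P i) *E Q = \sum_(i <- r | Pr i) P i *E Q.
Proof.
by apply: (big_morph (fun X => X *E Q)); [move=> *; exact: einsteinDl | exact: einstein0l].
Qed.

(* The powers of P are linearly dependent; factor a dependency at its lowest
   nonzero coefficient. *)
Lemma strongly_pi_regular J (P : tensor K J J) :
  exists l W, P ^E l = P ^E l.+1 *E W /\ P *E W = W *E P.
Proof.
pose m := #|{: J * J}|.
pose A : 'M[K]_(m.+1, m) := \matrix_(i, j) (P ^E i) (enum_val j).
have kerN0 : kermx A != 0.
  by rewrite kermx_eq0 -row_leq_rank -ltnNge ltnS rank_leq_col.
have [u uA uN0] : exists2 u : 'rV_m.+1, u *m A = 0 & u != 0.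
  have /rowV0Pn[u uk uN0] := kerN0.
  by exists u => //; apply/sub_kermxP.
have dep : \sum_(i < m.+1) tscale (u 0 i) (P ^E i) = 0.
  apply/ffunP=> x; rewrite sum_ffunE ffunE.
  have := congr1 (fun v : 'rV_m => v 0 (enum_rank x)) uA.
  rewrite !mxE => {2}<-.
  by apply: eq_bigr => i _; rewrite ffunE mxE enum_rankK.
have [i0 ui0] : exists i, u 0 i != 0.
  by have /rV0Pn := uN0.
case: (@arg_minnP _ i0 (fun i => u 0 i != 0) val ui0) => i ui imin.
pose W : tensor K J J := tscale (- (u 0 i)^-1)
  (\sum_(k < m.+1 | (i < k)%N) tscale (u 0 k) (P ^E (k - i.+1))).
exists i, W; split; last first.
  rewrite /W einsteinZr einsteinZl einstein_sumr einstein_suml.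
  congr tscale; apply: eq_bigr => k _.
  by rewrite einsteinZr einsteinZl -tpowS tpowSr.
rewrite /W einsteinZr einstein_sumr.
rewrite (eq_bigr (fun k : 'I_m.+1 => tscale (u 0 k) (P ^E k))) => [|k ik];
  last by rewrite einsteinZr -tpowD subnKC.
move: dep; rewrite (bigID (fun k : 'I_m.+1 => (i < k)%N)) /=.
rewrite [X in _ + X](bigD1 i) ?ltnn //= [X in _ + (_ + X)]big1 => [|k].
  rewrite addr0 => /eqP; rewrite addr_eq0 => /eqP ->.
  apply/ffunP=> x; rewrite !ffunE.
  by rewrite mulrNN mulrA mulVf // mul1r.
case/andP; rewrite -leqNgt => ki nki.
suff -> : u 0 k = 0 by apply/ffunP=> x; rewrite !ffunE mul0r.
apply/eqP; apply: contraNT nki => /imin ik.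
by apply/eqP/val_inj/eqP; rewrite eqn_leq ki ik.
Qed.

Lemma index_exists J (P : tensor K J J) :
  exists l, `[< trange (P ^E l) = trange (P ^E l.+1) >].
Proof.
have [l [W [PW _]]] := strongly_pi_regular P; exists l; apply/asboolP.
apply/seteqP; split=> _ [X _ <-] /=.
  by exists (W *E X) => //; rewrite einsteinA -PW.
by exists (P *E X) => //; rewrite einsteinA -tpowSr.
Qed.

End EinsteinTheory.

Definition tindex (K : fieldType) (J : finType) (P : tensor K J J) : nat :=
  ex_minn (index_exists P).

Definition is_drazin (K : fieldType) (J : finType) (P X : tensor K J J) : Prop :=
  forall l, (tindex P <= l)%N ->
  [/\ P ^E l *E X *E P = P ^E l, X *E P *E X = X & P *E X = X *E P].

(* [drazin_exists] and [drazin_unique] below show that the default value [0]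
   is never used and that any single l >= ind(P) determines the inverse. *)
Definition drazin (K : fieldType) (J : finType) (P : tensor K J J)
  : tensor K J J := xget 0 [set X | is_drazin P X]%classic.

Notation "P ^D" := (drazin P) (at level 2, left associativity, format "P ^D").

Definition nilpotent_tensor (K : fieldType) (J : finType) (l : nat)
    (P : tensor K J J) : Prop := (0 < l)%N /\ P ^E l = 0.

Section DrazinTheory.
Variables (K : fieldType) (J : finType).
Implicit Types P X Y : tensor K J J.

Lemma tindexP P l : (tindex P <= l)%N -> exists Y, P ^E l = P ^E l.+1 *E Y.
Proof.
rewrite /tindex; case: ex_minnP => m /asboolP rm _ ml.
have [Y PY] : exists Y, P ^E m = P ^E m.+1 *E Y.
  have col (j : J) : exists X : tensor K J unit,
      P ^E m.+1 *E X = P ^E m *E [ffun x => (x.1 == j)%:R].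
    have : trange (P ^E m) (P ^E m *E [ffun x => (x.1 == j)%:R]) by eexists.
    by rewrite rm => -[X _ <-]; exists X.
  have [f fE] := choice col.
  exists [ffun x : J * J => f x.2 (x.1, tt)]; apply/ffunP=> -[i j].
  have := congr1 (fun Z : tensor K J unit => Z (i, tt)) (fE j).
  rewrite /einstein !ffunE /= => E.
  transitivity (\sum_h (P ^E m) (i, h) * (h == j)%:R).
    rewrite (bigD1 j) //= eqxx mulr1 big1 ?addr0 // => h hj.
    by rewrite (negPf hj) mulr0.
  transitivity (\sum_h (P ^E m.+1) (i, h) * f j (h, tt)); last first.
    by apply: eq_bigr => h _; congr (_ * _); rewrite ffunE.
  by rewrite E; apply: eq_bigr => h _; congr (_ * _); rewrite ffunE.
exists Y.
by rewrite -(subnK ml) -addnS !tpowD -einsteinA -PY.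
Qed.

Lemma drazin_power P X k : X *E P *E X = X -> P *E X = X *E P ->
  X = P ^E k *E X ^E k.+1.
Proof.
move=> XPX PX; elim: k => [|k IHk]; first by rewrite tpow1 einstein1l.
rewrite tpowSr [X ^E k.+2]tpowS -einsteinA [P *E _]einsteinA PX.
by rewrite [X ^E k.+1]tpowS [X *E P *E _]einsteinA XPX -tpowS.
Qed.

Lemma drazin_eqs_unique P X Y k l :
    P ^E k *E X *E P = P ^E k -> X *E P *E X = X -> P *E X = X *E P ->
    P ^E l *E Y *E P = P ^E l -> Y *E P *E Y = Y -> P *E Y = Y *E P ->
  X = Y.
Proof.
move=> kX X2 XC lY Y2 YC.
have {}kX : P ^E (k + l) *E (X *E P) = P ^E (k + l).
  by rewrite addnC tpowD -einsteinA [P ^E k *E _]einsteinA kX.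
have {}lY : P ^E (k + l) *E (P *E Y) = P ^E (k + l).
  by rewrite YC tpowD -einsteinA [P ^E l *E _]einsteinA lY.
set n := (k + l)%N in kX lY.
have {}kX : X *E P *E P ^E n = P ^E n.
  by rewrite -einsteinA -tpowS tpowSr einsteinA -tpow_comm // -einsteinA kX.
transitivity (X *E P *E Y).
  rewrite {2}(drazin_power n X2 XC) -{1}(einstein1r X).
  rewrite einstein1r {1}(drazin_power n X2 XC).
  have C : P ^E n *E X ^E n.+1 = X ^E n.+1 *E P ^E n.
    by rewrite tpow_comm //; apply/esym/tpow_comm.
  by rewrite C -!einsteinA lY.
by rewrite {1}(drazin_power n Y2 YC) einsteinA kX -drazin_power.
Qed.

Lemma drazin_exists P : is_drazin P P^D.
Proof.
apply: (@xgetPex _ 0 [set X | is_drazin P X]%classic).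
have [l [W [PW WC]]] := strongly_pi_regular P.
have PWm k m : P ^E k *E W ^E m = W ^E m *E P ^E k.
  by rewrite tpow_comm //; apply/esym/tpow_comm.
have PWl k : P ^E l = P ^E (l + k) *E W ^E k.
  elim: k => [|k IHk]; first by rewrite addn0 einstein1r.
  apply: etrans IHk _; rewrite addnS -addSn [(l.+1 + k)%N]addnC addnC.
  by rewrite !tpowD [W ^E k.+1]tpowS {1}PW !einsteinA.
pose X := P ^E l *E W ^E l.+1; exists X.
have XC : P *E X = X *E P.
  rewrite /X -[RHS]einsteinA (tpow_comm l.+1 (esym WC)).
  by rewrite !einsteinA -tpowS tpowSr.
have XPl : X *E P *E P ^E l = P ^E l.
  rewrite -einsteinA -tpowS /X -einsteinA -PWm einsteinA -tpowD.
  by rewrite -PWl.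
have XPX : X *E P *E X = X by rewrite {2}/X einsteinA XPl.
have XPm m : P ^E m *E (X *E P) = X *E P *E P ^E m.
  by apply: tpow_comm; rewrite einsteinA XC.
move=> m /tindexP[Y mY].
have [Z mZ] : exists Z, P ^E m = P ^E l *E Z.
  suff [Z ->] : exists Z, P ^E m = P ^E (l + m) *E Z.
    by exists (P ^E m *E Z); rewrite tpowD einsteinA.
  elim: {+}l => [|k [Z IHk]]; first by exists \I; rewrite einstein1r.
  exists (Y *E Z); rewrite {1}IHk tpowD mY einsteinA -tpowD addnS -addSn.
  by rewrite !einsteinA.
split=> //.
by rewrite -einsteinA XPm mZ einsteinA XPl.
Qed.

Lemma drazin_unique P X l : (tindex P <= l)%N ->
    P ^E l *E X *E P = P ^E l -> X *E P *E X = X -> P *E X = X *E P ->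
  X = P^D.
Proof.
move=> Pl lX X2 XC; have [lD D2 DC] := drazin_exists Pl.
exact: drazin_eqs_unique lX X2 XC lD D2 DC.
Qed.

End DrazinTheory.

(* Main.v *)
Require Import Defs.
From HB Require Import structures.
From mathcomp Require Import all_boot all_order all_algebra complex reals.

Set Implicit Arguments.
Unset Strict Implicit.
Unset Printing Implicit Defensive.

Import GRing.Theory.
Local Open Scope ring_scope.

(** Write e = A A^D, an idempotent commuting with A, and p = 1 - e.  Split the
algebra of square tensors along e and p.  The hypothesis on T says that T is a
right inverse of the corner a = e S e inside the corner algebra with unit e;
in finite dimension it is then a two-sided inverse.  Since A = S + Y commutes
with e, the off-diagonal blocks e S p and p S e are those of - Y, so everything
can be computed in terms of S, e and T alone.

A Drazin inverse of S is obtained from a splitting of the space into an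
invariant part on which S is invertible and one on which it is nilpotent
([drazin_eqs_factor]): if U V = e, S V = V a and U S = a U, then V embeds and
U projects onto the invertible part, and V T U is the Drazin inverse as soon
as S is nilpotent on the kernel of the projection V U.

When e S p S = 0, one may take U = T S and
V = e + sum_(i < r - 1) S^i p S T^(i+1).  Indeed U S = e S = a U, while S V
and V a have the same terms up to a shift of the index, the two boundary terms
being p S e and (p S)^r T^(r-1) = 0.  On the kernel of V U the
element S acts as the nilpotent p S.  This is
[drazin_eqs_rows], and it gives (a).

The hypothesis of (b) forces p S e = 0 because a is invertible.  So in
particular S p S e = 0, the condition of (a) read in the opposite ring;
(b) is therefore the mirror image of (a) ([drazin_eqs_columns]).  The mirrored
nilpotency hypothesis concerns S p, for which (S p)^(r+1) = S (p S)^r p = 0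
replaces (p S)^r = 0; hence the sum of (b) has one more term. *)

(** * Square tensors as a ring *)

(** An alias is required because tensors, as finite functions, also carry
the entrywise operations; here the product is the Einstein product.  The ring
is allowed to be zero since the index type may be empty. *)
Definition square_tensor (K : fieldType) (J : finType) := tensor K J J.

HB.instance Definition _ (K : fieldType) (J : finType) :=
  GRing.Zmodule.on (square_tensor K J).
HB.instance Definition _ (K : fieldType) (J : finType) :=
  GRing.Zmodule_isPzRing.Build (square_tensor K J)
    (@einsteinA K J J J J) (@einstein1l K J J) (@einstein1r K J J)
    (fun x y z => @einsteinDl K J J J x y z)
    (fun x y z => @einsteinDr K J J J x y z).

Lemma tpowE (K : fieldType) (J : finType) (P : square_tensor K J) l :
  P ^E l = P ^+ l.
Proof. by elim: l => // l IHl; rewrite tpowS IHl exprS. Qed.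

(** * Drazin inverses in a ring *)

Definition drazin_eqs (R : pzRingType) (s x : R) (k : nat) : Prop :=
  [/\ s ^+ k * x * s = s ^+ k, x * s * x = x & s * x = x * s].

(** [V] and [U] exhibit [s] as the endomorphism [a], with inverse [T], on the
range of the idempotent [V * U]: both [s] times [V * T * U] and the reverse
product equal that idempotent, so only the power [s ^+ k] has to be supplied
with a proof that it vanishes on the complement. *)
Lemma drazin_eqs_factor (R : pzRingType) (s e a T U V : R) k :
    U * V = e -> V * e = V -> a * T = e -> T * a = e ->
    s * V = V * a -> U * s = a * U -> s ^+ k * (V * U) = s ^+ k ->
  drazin_eqs s (V * T * U) k.
Proof.
move=> UV Ve aT Ta sV Us sk.
have sX : s * (V * T * U) = V * U by rewrite !mulrA sV -(mulrA V a) aT Ve.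
have Xs : V * T * U * s = V * U by rewrite -mulrA Us !mulrA -(mulrA V T) Ta Ve.
split; last by rewrite sX Xs.
- by rewrite -mulrA Xs.
- by rewrite Xs !mulrA -(mulrA V U) UV Ve.
Qed.

(** Here [s] is the sum of its rows [e * s] and [Q = (1 - e) * s], and
[e * s * Q = 0] makes [s * Q] equal to [Q * Q].  Hence the geometric series
[V] of the [Q ^+ i * T ^+ i], starting with [e], intertwines [s] with the corner
[a = e * s * e]: multiplying by [s] on the left or by [a] on the right only
shifts it, and nilpotency of [Q] closes it. *)
Lemma drazin_eqs_rows (R : pzRingType) (s e T : R) n :
    e * e = e -> e * T = T -> T * e = T ->
    e * s * e * T = e -> T * (e * s * e) = e ->
    e * s * (1 - e) * s = 0 -> ((1 - e) * s) ^+ n.+1 = 0 ->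
  drazin_eqs s
    (T ^+ 2 * s + \sum_(0 <= i < n) s ^+ i * (1 - e) * s * T ^+ i.+3 * s) n.+1.
Proof.
move aE : (e * s * e) => a; move QE : ((1 - e) * s) => Q.
move=> ee eT Te aT Ta esps Qn.
have eQ : e * Q = 0 by rewrite -QE mulrA mulrBr mulr1 ee subrr mul0r.
have sE : s = e * s + Q by rewrite -QE -mulrDl addrC subrK mul1r.
have esQ : e * s * Q = 0 by rewrite -QE mulrA.
have sQ i : s ^+ i * Q = Q ^+ i.+1.
  elim: i => [|i IHi]; first by rewrite mul1r.
  rewrite exprS -mulrA IHi exprS mulrA {1}sE mulrDl esQ add0r.
  by rewrite [RHS]exprS exprS mulrA.
have esQi i : e * s * (s ^+ i * Q) = 0 by rewrite sQ exprS mulrA esQ mul0r.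
have TsE : T * s * e = e by rewrite -{1}Te -!mulrA (mulrA e) aE Ta.
pose V := e + \sum_(0 <= i < n) s ^+ i * Q * T ^+ i.+1.
have -> : T ^+ 2 * s + \sum_(0 <= i < n) s ^+ i * (1 - e) * s * T ^+ i.+3 * s
        = V * T * (T * s).
  rewrite mulrA -(mulrA _ T T) -expr2 /V !mulrDl !mulr_suml; congr (_ + _).
    by rewrite expr2 mulrA eT.
  apply: eq_bigr => i _.
  by rewrite -(mulrA _ (1 - e) s) QE -(addn2 i.+1) exprD !mulrA.
have Ve : V * e = V.
  rewrite mulrDl ee mulr_suml; congr (_ + _).
  by apply: eq_bigr => i _; rewrite exprSr -!mulrA Te.
have UV : T * s * V = e.
  rewrite mulrDr TsE mulr_sumr big1 ?addr0 // => i _.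
  rewrite mulrA -{1}Te -(mulrA T e s) -(mulrA T (e * s)) esQi mulr0.
  exact: mul0r.
have sV : s * V = V * a.
  (* The series for s * V and V * a differ by f n - f 0, and f n = 0. *)
  pose f i := s ^+ i * Q * (T ^+ i * e).
  have -> : s * V = s * e + \sum_(0 <= i < n) f i.+1.
    rewrite mulrDr mulr_sumr; congr (_ + _); apply: eq_bigr => i _.
    by rewrite /f [T ^+ _]exprSr -(mulrA _ T) Te exprS !mulrA.
  have -> : V * a = a + \sum_(0 <= i < n) f i.
    rewrite mulrDl mulr_suml -{1}aE !mulrA ee aE; congr (_ + _).
    by apply: eq_bigr => i _; rewrite /f exprSr -!mulrA Ta.
  have f0 : f 0%N = Q * e by rewrite /f !mul1r.
  have fn : f n = 0 by rewrite /f sQ Qn mul0r.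
  rewrite {1}sE mulrDl aE -addrA -f0 -big_nat_recl // big_nat_recr //= fn.
  by rewrite addr0.
have aU : a * (T * s) = e * s by rewrite mulrA aT.
have Us : T * s * s = a * (T * s).
  rewrite aU {2}sE mulrDr -{2}Te -!mulrA (mulrA e) esQ mulr0 addr0 mulrA.
  by rewrite mulrA TsE.
apply: (@drazin_eqs_factor _ s e a) => //.
have eV : e * V = e.
  rewrite mulrDr ee mulr_sumr big1 ?addr0 // => i _.
  by rewrite sQ exprS !mulrA eQ !mul0r.
set q := V * (T * s).
(* On the kernel of the projection q, s coincides with Q. *)
have sq : s * (1 - q) = (1 - q) * s.
  by rewrite mulrBr mulrBl mulr1 mul1r /q mulrA sV -!mulrA -Us !mulrA.
have esq : e * s * (1 - q) = 0.
  rewrite mulrBr mulr1 /q (mulrA _ V) -(mulrA e s V) sV (mulrA e V) eV.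
  by rewrite -(mulrA e a) aU mulrA ee subrr.
have skq k : s ^+ k * (1 - q) = Q ^+ k * (1 - q).
  elim: k => // k IHk; rewrite exprSr -mulrA sq mulrA IHk -mulrA -sq {1}sE.
  by rewrite mulrDl esq add0r mulrA exprSr.
apply/eqP; rewrite -subr_eq0 -opprB oppr_eq0 -{1}[s ^+ _]mulr1 -mulrBr skq Qn.
by rewrite mul0r.
Qed.

(** The Drazin equations are self-dual: [x] commutes with the powers of [s]. *)
Lemma drazin_eqs_converse (R : pzRingType) (s x : R) k :
  drazin_eqs (s : R^c) x k -> drazin_eqs s x k.
Proof.
rewrite /drazin_eqs revrX => -[sxs xsx] /esym sx.
have {}sx : s * x = x * s := sx.
have {}sxs : s * (x * s ^+ k) = s ^+ k := sxs.
split=> //; last by rewrite -mulrA.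
have xsk : x * s ^+ k = s ^+ k * x := commrX k (esym sx).
by rewrite -mulrA -sx mulrA -exprSr exprS -mulrA -xsk.
Qed.

(** Mirror image of [drazin_eqs_rows].  The condition [(1 - e) * s * e = 0]
yields [s * T = e], which collapses the outer factors [s] of the mirrored
formula.  Moving from [(1 - e) * s] to [s * (1 - e)] raises the order of
nilpotency by one, which is why the sum has [n] terms and not [n.-1]. *)
Lemma drazin_eqs_columns (R : pzRingType) (s e T : R) n :
    e * e = e -> e * T = T -> T * e = T ->
    e * s * e * T = e -> T * (e * s * e) = e ->
    (1 - e) * s * e = 0 -> ((1 - e) * s) ^+ n = 0 ->
  drazin_eqs s
    (T + \sum_(0 <= i < n) T ^+ i.+2 * s * (1 - e) * s ^+ i) n.+1.
Proof.
move=> ee eT Te aT Ta pse Qn.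
have sE : s * e = e * s * e.
  by apply/eqP; rewrite -subr_eq0 -mulrBl -{1}[s]mul1r -mulrBl pse.
have sT : s * T = e by rewrite -eT mulrA sE.
have psi i : (1 - e) * s ^+ i = ((1 - e) * s) ^+ i * (1 - e).
  elim: i => [|i IHi]; first by rewrite mulr1 mul1r.
  have psp : (1 - e) * s * (1 - e) = (1 - e) * s.
    by rewrite mulrBr mulr1 pse subr0.
  by rewrite exprSr mulrA IHi exprSr -!(mulrA (_ ^+ i)) psp.
have spn : (s * (1 - e)) ^+ n.+1 = 0.
  have -> i : (s * (1 - e)) ^+ i.+1 = s * ((1 - e) * s) ^+ i * (1 - e).
    elim: i => [|i IHi]; first by rewrite mulr1.
    by rewrite exprS IHi exprS !mulrA.
  by rewrite Qn mulr0 mul0r.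
apply: drazin_eqs_converse.
(* The formula of [drazin_eqs_rows] with the order of all products reversed. *)
rewrite [X in drazin_eqs _ X](_ : _ = (T : R^c) ^+ 2 * s
  + \sum_(0 <= i < n) (s : R^c) ^+ i * (1 - e) * s * (T : R^c) ^+ i.+3 * s).
  apply: (@drazin_eqs_rows R^c s e T n ee Te eT).
  - by rewrite -[LHS]/(T * (e * (s * e))) (mulrA e).
  - by rewrite -[LHS]/(e * (s * e) * T) (mulrA e).
  - by rewrite -[LHS]/(s * ((1 - e) * (s * e))) (mulrA (1 - e)) pse mulr0.
  - by rewrite revrX; exact: spn.
congr (_ + _).
  by rewrite revrX -[RHS]/(s * T ^+ 2) expr2 mulrA sT eT.
apply: eq_bigr => i _; rewrite !revrX.
rewrite -[RHS]/(s * (T ^+ i.+3 * (s * ((1 - e) * s ^+ i)))).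
by rewrite !exprS !mulrA sT eT.
Qed.

(** * The blocks of s in terms of y *)

Section PeirceIdentities.
Variables (R : pzRingType) (s y e T : R).
Hypotheses (ee : e * e = e) (eT : e * T = T) (Te : T * e = T).
Hypotheses (aT : e * s * e * T = e) (Ta : T * (e * s * e) = e).
(* In the application s + y is the tensor A, which commutes with A A^D. *)
Hypothesis sye : e * (s + y) = (s + y) * e.

Lemma idem_compl : e * (1 - e) = 0.
Proof. by rewrite mulrBr mulr1 ee subrr. Qed.

Lemma compl_idem : (1 - e) * e = 0.
Proof. by rewrite mulrBl mul1r ee subrr. Qed.

(** An element commuting with [e] is block diagonal, so the off-diagonal
blocks of [s] and [y] cancel. *)
Lemma offdiag_upper : e * s * (1 - e) = - (e * y * (1 - e)).
Proof.
apply/eqP; rewrite -addr_eq0 -mulrDl -mulrDr sye -mulrA idem_compl.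
by rewrite mulr0.
Qed.

Lemma offdiag_lower : (1 - e) * s * e = - ((1 - e) * y * e).
Proof.
apply/eqP; rewrite -addr_eq0 -mulrDl -mulrDr -mulrA -sye mulrA compl_idem.
by rewrite mul0r.
Qed.

Lemma corner_inverse_mul : T * s = e - T * y * (1 - e).
Proof.
have sE : e * s = e * s * e + e * s * (1 - e).
  by rewrite -mulrDr addrC subrK mulr1.
rewrite -{1}Te -mulrA sE mulrDr Ta offdiag_upper mulrN mulrA (mulrA T e y).
by rewrite Te.
Qed.

Lemma drazin_eqs_upper n :
    e * y * (1 - e) * s = 0 -> ((1 - e) * s) ^+ n.+1 = 0 ->
  drazin_eqs s
    (- (\sum_(0 <= i < n)
          s ^+ i * (1 - e) * y * T ^+ (i + 2) * (1 - T * y * (1 - e)))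
     + T - T ^+ 2 * y * (1 - e)) n.+1.
Proof.
move=> eyps Qn.
have esps : e * s * (1 - e) * s = 0 by rewrite offdiag_upper mulNr eyps oppr0.
have D := drazin_eqs_rows ee eT Te aT Ta esps Qn.
refine (eq_ind _ (fun x => drazin_eqs s x n.+1) D _ _).
have TsE k : T ^+ k.+2 * s = T ^+ k.+1 * (1 - T * y * (1 - e)).
  rewrite exprSr -mulrA corner_inverse_mul mulrBr [RHS]mulrBr mulr1.
  congr (_ - _).
  by rewrite exprSr -mulrA Te.
rewrite TsE expr1 mulrBr mulr1 !mulrA -expr2 addrC -addrA; congr (_ + _).
rewrite -sumrN; apply: eq_bigr => i _.
rewrite -mulrA TsE addn2 [T ^+ _]exprS -{1}eT !mulrA -!mulNr.
congr (_ * _ * _).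
rewrite -(mulrA _ (1 - e) s) -(mulrA _ _ e) offdiag_lower mulrN !mulrA !mulNr.
by rewrite -(mulrA _ e T) eT.
Qed.

Lemma drazin_eqs_lower n :
    (1 - e) * y * e * s = 0 -> ((1 - e) * s) ^+ n = 0 ->
  drazin_eqs s
    (- (\sum_(0 <= i < n) T ^+ (i + 2) * y * (1 - e) * s ^+ i) + T) n.+1.
Proof.
move=> pyes Qn.
have pse : (1 - e) * s * e = 0.
  (* The corner e * s * e can be cancelled on the right, with inverse T. *)
  have pses : (1 - e) * s * e * s = 0.
    by rewrite offdiag_lower mulNr pyes oppr0.
  have <- : (1 - e) * s * (e * s * e * T) = (1 - e) * s * e by rewrite aT.
  by rewrite !mulrA pses !mul0r.
have D := drazin_eqs_columns ee eT Te aT Ta pse Qn.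
refine (eq_ind _ (fun x => drazin_eqs s x n.+1) D _ _).
rewrite addrC -sumrN; congr (_ + _); apply: eq_bigr => i _.
rewrite addn2 exprSr -(mulrA _ T s) corner_inverse_mul -[RHS]mulNr.
congr (_ * _).
have pp : (1 - e) * (1 - e) = 1 - e by rewrite mulrBl mul1r idem_compl subr0.
rewrite -(mulrA _ _ (1 - e)) mulrBl idem_compl sub0r -(mulrA _ _ (1 - e)) pp.
by rewrite mulrN !mulrA.
Qed.

End PeirceIdentities.

(** * One-sided inverses and the Drazin inverse of tensors *)

(** If one-sided inverses are two-sided in a ring, the same holds in the corner
cut out by an idempotent [e]: adding [1 - e] turns elements of the corner into
elements of the ring and [e] into [1]. *)
Lemma corner_inverse_comm (R : pzRingType) (e a b : R) :
    (forall x z : R, x * z = 1 -> z * x = 1) -> e * e = e ->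
    a * e = a -> e * a = a -> e * b = b -> b * e = b ->
  a * b = e -> b * a = e.
Proof.
move=> fin ee ae ea eb be ab.
have shift x z : x * e = x -> e * z = z ->
    (x + (1 - e)) * (z + (1 - e)) = x * z + (1 - e).
  move=> xe ez.
  have xp : x * (1 - e) = 0 by rewrite mulrBr mulr1 xe subrr.
  have pz : (1 - e) * z = 0 by rewrite mulrBl mul1r ez subrr.
  rewrite mulrDl (mulrDr x) (mulrDr (1 - e)) xp pz addr0 add0r.
  by rewrite mulrBr mulr1 compl_idem // subr0.
have := fin (a + (1 - e)) (b + (1 - e)).
rewrite !shift // ab [e + _]addrC subrK => /(_ erefl) E.
by apply: (addIr (1 - e)); rewrite E addrC subrK.
Qed.

(** Finite dimensionality enters through strong pi-regularity:
[P ^+ l = P ^+ l.+1 * W] with [W] commuting with [P]; cancelling [P ^+ l] with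
its right inverse [Q ^+ l] makes [W] a left inverse of [P]. *)
Lemma einstein_one_sided_inverse (K : fieldType) (J : finType)
  (P Q : square_tensor K J) : P * Q = 1 -> Q * P = 1.
Proof.
move=> PQ; have [l [W [PW WC]]] : exists l (W : square_tensor K J),
    P ^+ l = P ^+ l.+1 * W /\ P * W = W * P.
  by have [l [W]] := strongly_pi_regular P; exists l, W; rewrite -!tpowE.
have PQl k : P ^+ k * Q ^+ k = 1.
  elim: k => [|k IHk]; first by rewrite mulr1.
  by rewrite exprSr exprS -mulrA (mulrA P) PQ mul1r.
have WP : W * P = 1.
  rewrite -[1](PQl l) PW exprSr -(mulrA _ P W) WC.
  have C : P ^+ l * (W * P) = W * P * P ^+ l.
    by apply/esym/commrX; rewrite /GRing.comm mulrA WC.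
  by rewrite C -mulrA PQl mulr1.
by have <- : W = Q by rewrite -[W]mulr1 -PQ mulrA WP mul1r.
Qed.

(** Two solutions of the Drazin equations agree even when their exponents
differ, so [k] need not be compared with the index of [P]. *)
Lemma drazin_eqsP (K : fieldType) (J : finType) (P X : square_tensor K J) k :
  drazin_eqs P X k -> P^D = X.
Proof.
case; rewrite -tpowE => kX X2 XC.
have [lD D2 DC] := drazin_exists (leqnn (tindex P)).
exact: (drazin_eqs_unique lD D2 DC kX X2 XC).
Qed.

(** The equations [e *E T = T] and [T *E e = T] place [T] in the corner of [e],
where it is then the two-sided inverse of [e *E S *E e]. *)
Lemma drazin_invertible_corner (K : fieldType) (J : finType)
    (S Y e T : tensor K J J) n :
    e *E e = e -> e *E T = T -> T *E e = T -> e *E (S + Y) = (S + Y) *E e ->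
    e *E S *E e *E T = e -> ((\I - e) *E S) ^E n.+1 = 0 ->
  (e *E Y *E (\I - e) *E S = 0 ->
     S^D = - (\sum_(0 <= i < n)
                 S ^E i *E (\I - e) *E Y *E T ^E (i + 2)
                   *E (\I - T *E Y *E (\I - e)))
           + T - T ^E 2 *E Y *E (\I - e))
  /\
  ((\I - e) *E Y *E e *E S = 0 ->
     S^D = - (\sum_(0 <= i < n.+1)
                 T ^E (i + 2) *E Y *E (\I - e) *E S ^E i) + T).
Proof.
pose sq X : square_tensor K J := X.
move=> ee eT Te eSY aT; rewrite (@tpowE K J) => Qn.
have ae : sq e * sq S * sq e * sq e = sq e * sq S * sq e.
  by rewrite -mulrA [sq e * sq e]ee.
have ea : sq e * (sq e * sq S * sq e) = sq e * sq S * sq e.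
  by rewrite !mulrA [sq e * sq e]ee.
have fin := @einstein_one_sided_inverse K J.
have Ta := corner_inverse_comm fin ee ae ea eT Te aT.
split=> YS.
- rewrite (drazin_eqsP (@drazin_eqs_upper (square_tensor K J) S Y e T
    ee eT Te aT Ta eSY _ YS Qn)).
  congr (- _ + _ - _); last by rewrite (@tpowE K J).
  by apply: eq_bigr => i _; rewrite !(@tpowE K J).
- rewrite (drazin_eqsP (@drazin_eqs_lower (square_tensor K J) S Y e T
    ee eT Te aT Ta eSY _ YS Qn)).
  by congr (- _ + _); apply: eq_bigr => i _; rewrite !(@tpowE K J).
Qed.

(** * The Drazin inverse of the generalized Schur complement *)

Theorem theorem3p7 (R : realType) (N M : nat)
    (dI : 'I_N -> nat) (dH : 'I_M -> nat)
    (N_gt0 : (0 < N)%N) (M_gt0 : (0 < M)%N)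
    (dI_gt0 : forall k, (0 < dI k)%N) (dH_gt0 : forall k, (0 < dH k)%N)
    (A : tensor R[i] (multiindex dI) (multiindex dI))
    (B : tensor R[i] (multiindex dH) (multiindex dI))
    (C : tensor R[i] (multiindex dI) (multiindex dH))
    (D : tensor R[i] (multiindex dH) (multiindex dH)) (r : nat) :
  let Ae := A *E A^D in
  let Api := \I - A *E A^D in
  let Y := C *E D^D *E B in
  let S := A - C *E D^D *E B in
  let Z := D - B *E A^D *E C in
  let H := B *E A^D in
  let K := A^D *E C in
  let SAe := Ae *E S *E Ae in
  let T := A^D + K *E Z^D *E H in
  SAe *E T = A *E A^D ->
  nilpotent_tensor r (Api *E S) ->
  (Ae *E Y *E Api *E S = 0 ->
     S^D = - (\sum_(0 <= i < r.-1)
                 S ^E i *E Api *E Y *E T ^E (i + 2) *E (\I - T *E Y *E Api))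
           + T - T ^E 2 *E Y *E Api)
  /\
  (Api *E Y *E Ae *E S = 0 ->
     S^D = - (\sum_(0 <= i < r) T ^E (i + 2) *E Y *E Api *E S ^E i) + T).
Proof.
move=> Ae Api Y S Z H Kt SAe T.
have [_ D2 DC] := drazin_exists (leqnn (tindex A)).
(* e = A A^D absorbs A^D, hence T, which begins and ends with A^D. *)
have De : A^D *E Ae = A^D by rewrite /Ae einsteinA.
have eD : Ae *E A^D = A^D by rewrite /Ae DC.
have eT : Ae *E T = T by rewrite /T einsteinDr eD /Kt !einsteinA eD.
have Te : T *E Ae = T by rewrite /T einsteinDl De /H -!einsteinA De.
have ee : Ae *E Ae = Ae by rewrite -[LHS]/(A *E A^D *E Ae) -einsteinA De.
have SY : S + Y = A by rewrite subrK.
have eSY : Ae *E (S + Y) = (S + Y) *E Ae.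
  by rewrite SY /Ae -einsteinA -DC.
move=> SeT [r_gt0 Qr].
have [m rE] : exists m, r = m.+1 by exists r.-1; rewrite prednK.
subst r; clear r_gt0.
exact: (drazin_invertible_corner ee eT Te eSY SeT Qr).
Qed.
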